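(* Let $n\ge 4$ be an integer, let $\varepsilon>0$ be a sufficiently small real number, let $s_1,s_2$ be real numbers with $0<s_1+s_2<1$, and let $(d_1,d_2)\in\mathbb{R}^2$ be a fixed point. Then there exist constants $c_7>0$ and $Q_0>0$, independent of $Q$, such that for every integer $Q>Q_0$ the following holds: if $E=I_1\times I_2$ is a rectangle with midpoint $(d_1,d_2)$, where $I_1,I_2$ are intervals of lengths $|I_1|=Q^{-s_1}$ and $|I_2|=Q^{-s_2}$ (so that $\mu_2 E=Q^{-s_1-s_2}$), and if $$E\cap\left\{(x,y)\in\mathbb{R}^2:\ |x-y|\le\varepsilon\right\}=\varnothing,$$ then $E$ contains at least $c_7\,Q^{n}\mu_2E$ algebraic integer points $(\alpha,\beta)$ of degree $\deg\alpha=\deg\beta=n$ and height $H(\alpha)=H(\beta)\le Q$.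
   Context: For a polynomial $P(t)=a_nt^n+\ldots+a_1t+a_0$ with integer coefficients, its height is $H(P)=\max_{0\le j\le n}|a_j|$. An algebraic integer $\alpha$ of degree $n$ is a root of a monic polynomial $P(t)=t^n+a_{n-1}t^{n-1}+\ldots+a_1t+a_0$ with integer coefficients that is irreducible over $\mathbb{Q}$; its height is $H(\alpha)=H(P)$ (the leading coefficient $1$ is included in the maximum). An algebraic integer point is a point $(\alpha,\beta)\in\mathbb{R}^2$ such that $\alpha$ and $\beta$ are algebraically conjugate algebraic integers, i.e. roots of the same irreducible monic integer polynomial. $\mu_2$ denotes Lebesgue measure on $\mathbb{R}^2$ and $|I|$ the length of an interval $I$. The constants $c_7$ and $Q_0$ may depend on $n$, $s_1,s_2$, $d_1,d_2$ and $\varepsilon$. *)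

(* Defs.v *)
From mathcomp Require Import all_boot all_order all_algebra finmap.
From mathcomp Require Import all_classical all_reals all_analysis.
Set Implicit Arguments.
Unset Strict Implicit.
Unset Printing Implicit Defensive.
Import Order.TTheory GRing.Theory Num.Theory.
Local Open Scope classical_set_scope.
Local Open Scope ring_scope.

Definition poly_height (P : {poly int}) : nat :=
  \max_(j < size P) absz (P`_j)%R.

(* P is the irreducible monic integer polynomial of the real algebraic integer
   a; it is unique, so that deg a = (size P).-1 and H(a) = poly_height P. *)
Definition is_min_poly (R : realType) (P : {poly int}) (a : R) : Prop :=
  [/\ P \is monic,
      irreducible_poly (map_poly (intr : int -> rat) P) &
      root (map_poly (intr : int -> R) P) a].

Definition alg_int_points (R : realType) (n Q : nat) : set (R * R) :=
  [set p | exists P : {poly int},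
     [/\ is_min_poly P p.1, is_min_poly P p.2,
         size P = n.+1 & (poly_height P <= Q)%N]].

(* The two booleans let each endpoint be included or excluded. *)
Definition interval_mid_len (R : realType) (d l : R) (I : set R) : Prop :=
  exists (a b : R) (ca cb : bool),
    [/\ I = [set` Interval (BSide ca a) (BSide cb b)],
        (a + b) / 2 = d & b - a = l].

Definition mu2 (R : realType) (E : set (R * R)) : \bar R :=
  ((@lebesgue_measure R) \x (@lebesgue_measure R))%E E.

(* Main.v *)
Require Import Defs.
From mathcomp Require Import all_boot all_order all_algebra finmap.
From mathcomp Require Import all_classical all_reals all_analysis.
From mathcomp Require Import ring lra zify.
Set Implicit Arguments.
Unset Strict Implicit.
Unset Printing Implicit Defensive.
Import Order.TTheory GRing.Theory Num.Theory.
Local Open Scope classical_set_scope.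
Local Open Scope ring_scope.

(** Suppose that [d1 <> d2] and that [s1, s2 >= 0].  Fix the coefficients
[a_2, ..., a_(n-1)] of a monic polynomial [P].  The map
[(a_0, a_1) |-> (P(d1), P(d2))] is affine with determinant [d2 - d1], so the
pairs with [|P(d1)| << Q^(1 - s1)] and [|P(d2)| << Q^(1 - s2)] fill a
parallelogram whose two widths tend to infinity, because [s1 + s2 < 1] makes both
exponents positive.  Up to a constant factor it contains as many integer points
as its area, even when a congruence is imposed on them.  Letting
[a_2, ..., a_(n-1)] run through intervals of length [~ Q] gives
[~ Q^(n-2) Q^(1-s1) Q^(1-s2) = Q^n mu_2(E)] polynomials.  Three things remain to
be secured.

- Irreducibility.  All coefficients but the leading one are taken even and
  [a_0 = 2 mod 4], so that Eisenstein's criterion at 2 applies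
  ([irreducible_family_poly]).

- Roots near [d1] and [d2].  Dividing by [(x - d1)(x - d2)] gives
  [P(x) = (x - d1)(x - d2) G(x) + l x + m].  If [a_2] lies in [2KM, 2(K+1)M)
  and the other [a_i] have size at most [2M], with [M ~ Q] and [K] a large
  constant, then [a_2], whose monomial has quotient 1, dominates [G], and
  [G >= KM] on a fixed neighbourhood ([quotient_lower_bound]).  The linear part
  takes the values [P(d1)] and [P(d2)] at [d1] and [d2], which are kept below
  [h1 M] and [h2 M], with [h1 ~ Q^(-s1)] and [h2 ~ Q^(-s2)].  At distance [h1]
  from [d1] the product has size at least [h1 K M |d1 - d2| / 2]; it outweighs
  the linear part and has opposite signs on the two sides of [d1], whence a root
  ([crossing_root]).  The same holds at [d2].

- Distinctness.  A real number has only one monic irreducible integer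
  polynomial ([min_poly_unique]), so distinct polynomials give distinct points.

The choice of [(a_0, a_1)] is made by aiming at the points [(i L, j L)] of a grid
for the values [(P(d1), P(d2))], whose step [L] exceeds twice the rounding error
([lattice_point_near]); the indices [i, j] can then be recovered from [P].

If [s1 < 0] or [s2 < 0], or if [d1 = d2], the rectangle meets the diagonal for
all large [Q], against the hypothesis that it avoids the strip
([wide_interval_contains]). *)

(** * Division of monomials by (x - d1)(x - d2) *)

(** [x ^ n] is congruent to [a x + b] modulo [(x - d1)(x - d2)], where [(a, b)]
is this pair; the recursion reduces [x (a x + b)]. *)
Fixpoint quad_rem (R : realType) (d1 d2 : R) (n : nat) : R * R :=
  if n is m.+1 then
    let ab := quad_rem d1 d2 m in ((d1 + d2) * ab.1 + ab.2, - (d1 * d2 * ab.1))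
  else (0, 1).

Fixpoint quad_quo (R : realType) (d1 d2 : R) (n : nat) (x : R) : R :=
  if n is m.+1 then x * quad_quo d1 d2 m x + (quad_rem d1 d2 m).1 else 0.

Lemma exprn_quad_div (R : realType) (d1 d2 x : R) (n : nat) :
  x ^+ n = (x - d1) * (x - d2) * quad_quo d1 d2 n x
           + ((quad_rem d1 d2 n).1 * x + (quad_rem d1 d2 n).2).
Proof.
elim: n => [|n IHn] /=; first by rewrite expr0; ring.
by rewrite exprS {}IHn; ring.
Qed.

Lemma quad_div_bounded (R : realType) (d1 d2 r : R) (n : nat) :
  exists2 C : R, 0 < C & forall i, (i <= n)%N ->
    [/\ `|(quad_rem d1 d2 i).1| <= C, `|(quad_rem d1 d2 i).2| <= C &
        forall x, `|x| <= r -> `|quad_quo d1 d2 i x| <= C].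
Proof.
elim: n => [|n [C C0 IHn]].
  exists 1 => // i; rewrite leqn0 => /eqP -> /=.
  by split; rewrite ?normr0 ?normr1 // => x _; rewrite normr0.
have [C1 C2 C3] := IHn n (leqnn n).
set C' := C + (`|d1| + `|d2|) * C + `|d1| * `|d2| * C + `|r| * C.
have e1 : 0 <= (`|d1| + `|d2|) * C by rewrite mulr_ge0 ?addr_ge0// ltW.
have e2 : 0 <= `|d1| * `|d2| * C by rewrite !mulr_ge0// ltW.
have e3 : 0 <= `|r| * C by rewrite mulr_ge0// ltW.
have CC' : C <= C' by rewrite /C'; lra.
exists C'; first exact: lt_le_trans CC'.
move=> i; rewrite leq_eqVlt => /predU1P[->|]; last first.
  rewrite ltnS => /IHn[D1 D2 D3]; split; rewrite ?(le_trans D1) ?(le_trans D2)//.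
  by move=> x /D3 H; exact: le_trans CC'.
split => /=.
- apply: (le_trans (ler_normD _ _)); rewrite normrM.
  have : `|d1 + d2| * `|(quad_rem d1 d2 n).1| <= (`|d1| + `|d2|) * C.
    by rewrite ler_pM// ler_normD.
  by rewrite /C'; lra.
- rewrite normrN !normrM.
  have : `|d1| * `|d2| * `|(quad_rem d1 d2 n).1| <= `|d1| * `|d2| * C.
    by rewrite ler_wpM2l// mulr_ge0.
  by rewrite /C'; lra.
- move=> x xr; apply: (le_trans (ler_normD _ _)); rewrite normrM.
  have : `|x| * `|quad_quo d1 d2 n x| <= `|r| * C.
    by rewrite ler_pM ?C3// (le_trans xr)// ler_norm.
  by rewrite /C'; lra.
Qed.

Lemma horner_quad_div (R : realType) (d1 d2 x : R) (p : {poly R}) (N : nat) :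
  (size p <= N.+2)%N ->
  p.[x] = (x - d1) * (x - d2) * (\sum_(i < N) p`_i.+2 * quad_quo d1 d2 i.+2 x)
    + ((p`_1 + \sum_(i < N) p`_i.+2 * (quad_rem d1 d2 i.+2).1) * x
       + (p`_0 + \sum_(i < N) p`_i.+2 * (quad_rem d1 d2 i.+2).2)).
Proof.
move=> sp; rewrite (horner_coef_wide _ sp) !big_ord_recl.
rewrite (eq_bigr (fun i : 'I_N =>
  (x - d1) * (x - d2) * (p`_i.+2 * quad_quo d1 d2 i.+2 x)
  + (p`_i.+2 * (quad_rem d1 d2 i.+2).1 * x + p`_i.+2 * (quad_rem d1 d2 i.+2).2)));
  last first.
  by move=> i _; rewrite !lift0 (exprn_quad_div d1 d2); ring.
rewrite !big_split -mulr_sumr -mulr_suml expr0 expr1 /=; ring.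
Qed.

(** Here [t i] stands for the coefficient of index [i + 2] and [H i] for the value
of the quotient of [x ^ (i + 2)] by [(x - d1)(x - d2)]: the first term is at least
[2 K M], and the [N] others together are at least [- K M]. *)
Lemma quotient_lower_bound (R : realType) (N K M : nat) (C : R)
    (t H : nat -> R) :
  H 0 = 1 -> (forall i, (0 < i <= N)%N -> `|H i| <= C) ->
  (2 * K * M)%:R <= t 0 -> (forall i, (0 < i <= N)%N -> `|t i| <= (2 * M)%:R) ->
  2 * N%:R * C <= K%:R ->
  K%:R * M%:R <= \sum_(i < N.+1) t i * H i.
Proof.
move=> H0 HC t0 tM NC; rewrite big_ord_recl/= H0 mulr1.
have : `|\sum_(i < N) t (bump 0 i) * H (bump 0 i)| <= \sum_(i < N) (2 * M)%:R * C.
  apply: (le_trans (ler_norm_sum _ _ _)); apply: ler_sum => i _.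
  rewrite normrM ler_pM// ?tM ?HC//; rewrite /bump/= add1n; exact: ltn_ord.
rewrite sumr_const card_ord -mulr_natr ler_norml => /andP[+ _].
have : 2 * N%:R * C * M%:R <= K%:R * M%:R by rewrite ler_wpM2r.
by move: t0; rewrite !natrM; lra.
Qed.

(** * Sign changes and rounding *)

(** The lower bound [g] on [G] makes the product at least [h * |d - d'| / 2 * g]
in absolute value at the two points [d - h] and [d + h], where its signs differ.
The linear part is too small there to alter these signs. *)
Lemma crossing_root (R : realType) (p : {poly R}) (d d' h l m g : R)
    (G : R -> R) :
  0 < h -> h <= `|d - d'| / 2 ->
  (forall x, p.[x] = (x - d) * (x - d') * G x + (l * x + m)) ->
  (forall x, `|x - d| <= h -> g <= G x) ->
  `|l * d + m| + `|l| * h < h * (`|d - d'| / 2) * g ->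
  exists2 x, `|x - d| <= h & root p x.
Proof.
move=> h0 hD pE Gg small.
have g0 : 0 < g.
  have w0 : 0 < h * (`|d - d'| / 2) by rewrite mulr_gt0// (lt_le_trans h0).
  rewrite -(pmulr_rgt0 _ w0); apply: le_lt_trans small.
  by rewrite addr_ge0// mulr_ge0// ltW.
have lin y : `|y| <= h -> `|l * (d + y) + m| < h * (`|d - d'| / 2) * g.
  move=> yh; apply: le_lt_trans small.
  rewrite (_ : l * (d + y) + m = (l * d + m) + l * y); last by ring.
  by rewrite (le_trans (ler_normD _ _))// lerD2l normrM ler_wpM2l.
have hh : `|h| <= h by rewrite ger0_norm// ltW.
have hNh : `|- h| <= h by rewrite normrN.
have inG y : `|y| <= h -> g <= G (d + y).
  by move=> yh; apply: Gg; rewrite addrAC subrr add0r.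
have qb (c y : R) : `|y| <= h -> `|d - d'| / 2 <= c ->
    h * (`|d - d'| / 2) * g <= h * c * G (d + y).
  move=> yh cD; have D0 := le_trans (ltW h0) hD.
  rewrite ler_pM ?inG//; first by rewrite mulr_ge0// ltW.
    exact: ltW.
  by rewrite ler_wpM2l// ltW.
have dh : d - h <= d + h by lra.
have [dd'|dd'|dd'] := ltgtP d' d.
- have nD : `|d - d'| = d - d' by rewrite ger0_norm//; lra.
  have [|x xI rx] := @poly_ivt _ p (d - h) (d + h) dh.
    rewrite !pE.
    have := lin h hh; have := lin (- h) hNh; rewrite !ltr_norml.
    have := qb (d - d' + h) h hh; have := qb (d - d' - h) (- h) hNh.
    rewrite !nD in hD *.
    move=> /(_ ltac:(lra)) q1 /(_ ltac:(lra)) q2 /andP[_ l1] /andP[l2 _].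
    rewrite (_ : (d - h - d) * (d - h - d') = - (h * (d - d' - h))); last by ring.
    rewrite (_ : (d + h - d) * (d + h - d') = h * (d - d' + h)); last by ring.
    by apply/andP; split; rewrite ?mulNr; lra.
  by exists x => //; rewrite ler_norml; lra.
- have nD : `|d - d'| = d' - d by rewrite ltr0_norm; lra.
  have [|x xI rx] := @poly_ivt _ (- p) (d - h) (d + h) dh.
    rewrite !hornerN !pE.
    have := lin h hh; have := lin (- h) hNh; rewrite !ltr_norml.
    have := qb (d' - d - h) h hh; have := qb (d' - d + h) (- h) hNh.
    rewrite !nD in hD *.
    move=> /(_ ltac:(lra)) q1 /(_ ltac:(lra)) q2 /andP[l1 _] /andP[_ l2].
    rewrite (_ : (d - h - d) * (d - h - d') = h * (d' - d + h)); last by ring.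
    rewrite (_ : (d + h - d) * (d + h - d') = - (h * (d' - d - h))); last by ring.
    by apply/andP; split; rewrite ?mulNr; lra.
  by exists x; [rewrite ler_norml; lra|rewrite -rootN].
- by move: hD; rewrite dd' subrr normr0 mul0r; lra.
Qed.

(** The unknowns are shifted by [u] and [v], the contributions of the higher
coefficients to the linear part.  Rounding the real solution of the
interpolation problem to an even number and to a number congruent to 2 modulo 4
moves each of its two coordinates by at most 2. *)
Lemma lattice_point_near (R : realType) (d1 d2 u v v1 v2 : R) : d1 != d2 ->
  exists b1 b0 : int,
    let f x := ((2 * b1)%:~R + u) * x + ((4 * b0 + 2)%:~R + v) in
    `|f d1 - v1| <= 2 * (`|d1| + 1) /\ `|f d2 - v2| <= 2 * (`|d2| + 1).
Proof.
move=> d12.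
have [l [m [ld1 ld2]]] : exists l m : R, l * d1 + m = v1 /\ l * d2 + m = v2.
  exists ((v1 - v2) / (d1 - d2)), (v1 - (v1 - v2) / (d1 - d2) * d1).
  by split; field; rewrite subr_eq0.
exists (Num.floor ((l - u) / 2)), (Num.floor ((m - v) / 4)) => f.
have near x : `|f x - (l * x + m)| <= 2 * (`|x| + 1).
  rewrite /f.
  have := floor_itv ((l - u) / 2); set b1 := Num.floor ((l - u) / 2).
  have := floor_itv ((m - v) / 4); set b0 := Num.floor ((m - v) / 4).
  rewrite !intrD !intrM => /andP[p1 p2] /andP[q1 q2].
  rewrite (_ : _ * x + _ - _ =
    (2 * b1%:~R + u - l) * x + (4 * b0%:~R + 2 + v - m)); last by ring.
  apply: (le_trans (ler_normD _ _)); rewrite normrM mulrDr mulr1 lerD//.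
    by rewrite ler_wpM2r// ler_norml; lra.
  by rewrite ler_norml; lra.
by split; [rewrite -ld1|rewrite -ld2]; exact: near.
Qed.

(** * A family of Eisenstein polynomials *)

(** Two distinct monic irreducible polynomials over the rationals are coprime,
and stay so over the reals, where a common root would contradict Bezout. *)
Lemma min_poly_unique (R : realType) (P P' : {poly int}) (a : R) :
  is_min_poly P a -> is_min_poly P' a -> P = P'.
Proof.
move=> [mP iP rP] [mP' iP' rP'].
have toR p : map_poly (intr : int -> R) p =
    map_poly (ratr : rat -> R) (map_poly (intr : int -> rat) p).
  by rewrite -map_poly_comp; apply: eq_map_poly => z /=; rewrite ratr_int.
set p := map_poly _ P in iP; set p' := map_poly _ P' in iP'.
have ncop : ~~ coprimep p p'.
  apply/negP; rewrite -(coprimep_map (ratr : rat -> R)) => /coprimep_root.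
  by move=> /(_ a); rewrite -!toR => /(_ rP); rewrite -rootE rP'.
have pp' : p %= p'.
  apply: (@eqp_trans _ (gcdp p p')); last first.
    by apply: iP'.2; rewrite ?dvdp_gcdr.
  by rewrite eqp_sym; apply: iP.2; rewrite ?dvdp_gcdl.
have inj : injective (map_poly (intr : int -> rat)).
  by apply: map_inj_poly => //; exact: intr_inj.
by apply: inj; apply/eqP; rewrite -eqp_monic// monic_map.
Qed.

Lemma eisenstein2 (P : {poly int}) : P \is monic -> (1 < size P)%N ->
  (forall i, (i < (size P).-1)%N -> (2 %| P`_i)%Z) -> ~~ (4 %| P`_0)%Z ->
  irreducible_poly (map_poly (intr : int -> rat) P).
Proof.
move=> mP sP even n4; apply/irreducible_rat_int/(@eisenstein_crit 2) => //.
  by rewrite neq_ltn sP orbT.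
by rewrite (monicP mP).
Qed.

(** [a_2 = 2 (K M + k 0)] is the dominant coefficient, the [a_(i+2) = 2 k i]
follow, and the leading coefficient, of index [n + 3], is 1. *)
Definition tail_coef (n K M : nat) (k : nat -> nat) (i : nat) : int :=
  if i == n.+1 then 1 else (2 * ((i == 0) * (K * M) + k i))%N.

Definition family_poly (n K M : nat) (k : nat -> nat) (a0 a1 : int) :=
  \poly_(i < n.+4)
    match i with 0 => a0 | 1 => a1 | j.+2 => tail_coef n K M k j end.

Lemma size_family_poly (n K M : nat) (k : nat -> nat) (a0 a1 : int) :
  size (family_poly n K M k a0 a1) = n.+4.
Proof. by rewrite size_poly_eq//= /tail_coef eqxx. Qed.

Lemma coef_family_poly (n K M : nat) (k : nat -> nat) (a0 a1 : int) (i : nat) :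
  (i < n.+2)%N -> (family_poly n K M k a0 a1)`_i.+2 = tail_coef n K M k i.
Proof. by move=> i2; rewrite coef_poly -[(i.+2 < _)%N]/(i < n.+2)%N i2. Qed.

Lemma coef0_family_poly (n K M : nat) (k : nat -> nat) (a0 a1 : int) :
  (family_poly n K M k a0 a1)`_0 = a0.
Proof. by rewrite coef_poly. Qed.

Lemma coef1_family_poly (n K M : nat) (k : nat -> nat) (a0 a1 : int) :
  (family_poly n K M k a0 a1)`_1 = a1.
Proof. by rewrite coef_poly. Qed.

Lemma monic_family_poly (n K M : nat) (k : nat -> nat) (a0 a1 : int) :
  family_poly n K M k a0 a1 \is monic.
Proof.
rewrite monicE lead_coefE size_family_poly/= coef_family_poly//.
by rewrite /tail_coef eqxx.
Qed.

Lemma irreducible_family_poly (n K M : nat) (k : nat -> nat) (b0 b1 : int) :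
  irreducible_poly (map_poly (intr : int -> rat)
    (family_poly n K M k (4 * b0 + 2) (2 * b1))).
Proof.
apply: eisenstein2; rewrite ?size_family_poly//.
- exact: monic_family_poly.
- case=> [|[|i]] /=; rewrite ?coef0_family_poly ?coef1_family_poly.
  + by move=> _; lia.
  + by move=> _; rewrite dvdz_mulr.
  + rewrite !ltnS => i1; rewrite coef_family_poly; last exact: ltnW.
    by rewrite /tail_coef ltn_eqF// dvdzE/= dvdn_mulr.
- by rewrite coef0_family_poly; lia.
Qed.

Lemma tail_coef_le (n K M : nat) (k : nat -> nat) (i : nat) :
  (0 < M)%N -> (k i < M)%N -> (absz (tail_coef n K M k i) <= 2 * K.+1 * M)%N.
Proof.
move=> M0 kM; rewrite /tail_coef; case: eqP => _ /=.
  by rewrite !muln_gt0 M0.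
rewrite -mulnA leq_mul2l/= mulSn addnC; apply: leq_add; first exact: ltnW.
by rewrite -[leqRHS]mul1n leq_mul2r leq_b1 orbT.
Qed.

Lemma tail_coef_small (n K M : nat) (k : nat -> nat) (i : nat) :
  (0 < M)%N -> (k i < M)%N -> (0 < i)%N ->
  (absz (tail_coef n K M k i) <= 2 * M)%N.
Proof.
move=> M0 kM; rewrite /tail_coef; case: eqP => _ /=; first by rewrite muln_gt0 M0.
by case: i kM => //= i kM _; rewrite mul0n add0n leq_mul2l/= ltnW.
Qed.

(** * Polynomials with prescribed values, and their roots *)

Lemma natr_absz_norm (R : realType) (z : int) : (absz z)%:R = `|z%:~R| :> R.
Proof. by rewrite -[LHS]/((absz z)%:~R) abszE intr_norm. Qed.

(** The conclusion keeps all the data from which [k] and, as the targets [v1] and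
[v2] range over a grid, the targets themselves can be recovered from [P].  The
bound [|v1| + 2 (|d1| + 1) <= h1 M] leaves room for the rounding error. *)
Lemma exists_eisenstein_poly (R : realType) (n : nat) (d1 d2 : R) : d1 != d2 ->
  exists (K B : nat) (h0 : R), [/\ (0 < B)%N, 0 < h0 &
    forall (M : nat) (h1 h2 v1 v2 : R) (k : nat -> nat),
    (0 < M)%N -> 0 < h1 <= h0 -> 0 < h2 <= h0 -> (forall i, (k i < M)%N) ->
    `|v1| + 2 * (`|d1| + 1) <= h1 * M%:R ->
    `|v2| + 2 * (`|d2| + 1) <= h2 * M%:R ->
    exists P : {poly int}, let PR := map_poly (intr : int -> R) P in
      [/\ P \is monic, irreducible_poly (map_poly (intr : int -> rat) P),
          size P = n.+4 & (poly_height P <= B * M)%N] /\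
      [/\ forall i, (i < n.+1)%N -> P`_i.+2 = (2 * ((i == 0) * (K * M) + k i))%N,
          `|PR.[d1] - v1| <= 2 * (`|d1| + 1),
          `|PR.[d2] - v2| <= 2 * (`|d2| + 1),
          exists2 x, `|x - d1| <= h1 & root PR x &
          exists2 x, `|x - d2| <= h2 & root PR x]].
Proof.
move=> d12; pose D : R := `|d1 - d2|.
have D0 : 0 < D by rewrite normr_gt0 subr_eq0.
have [C C0 Cbd] := quad_div_bounded d1 d2 (`|d1| + `|d2| + 1) n.+3.
(* [K] makes [a_2] dominate the quotient (first condition) and the product
   dominate the linear part (second condition). *)
pose K := (Num.truncn (2 * n.+1%:R * C + 2 * (1 + 2 / D) / D)).+1.
have [K1 K2] : 2 * n.+1%:R * C <= K%:R /\ 2 * (1 + 2 / D) / D < K%:R.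
  have := truncnS_gt (2 * n.+1%:R * C + 2 * (1 + 2 / D) / D); rewrite -/K.
  have : 0 <= 2 * n.+1%:R * C by rewrite !mulr_ge0// ltW.
  have : 0 <= 2 * (1 + 2 / D) / D.
    by rewrite divr_ge0 ?mulr_ge0 ?addr_ge0 ?divr_ge0 ?ltW.
  by lra.
(* The first summand bounds the higher coefficients and what they contribute to
   [a_0] and [a_1], the second one the coefficients [l] and [m] of the linear
   part; everything is in units of [M]. *)
pose B0 : R := 2 * K.+1%:R * (1 + n.+2%:R * C) + (1 + 2 / D + 2 / D * `|d1|).
pose B := (Num.truncn B0).+1.
have BB0 : B0 <= B%:R by exact/ltW/truncnS_gt.
exists K, B, (Num.min 1 (D / 2)); split => //.
  by rewrite lt_min ltr01 divr_gt0.
move=> M h1 h2 v1 v2 k M0 /andP[h1_0]; rewrite le_min => /andP[h1_1 h1D].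
move=> /andP[h2_0]; rewrite le_min => /andP[h2_1 h2D] kM v1M v2M.
have M0R : (0 : R) < M%:R by rewrite ltr0n.
pose t i : R := (tail_coef n K M k i)%:~R.
pose T : R := 2 * K.+1%:R * M%:R.
have tT i : `|t i| <= T.
  by rewrite -natr_absz_norm /T -!natrM ler_nat tail_coef_le.
pose S1 : R := \sum_(i < n.+2) t i * (quad_rem d1 d2 i.+2).1.
pose S2 : R := \sum_(i < n.+2) t i * (quad_rem d1 d2 i.+2).2.
have sumT (f : nat -> R) : (forall i, (i <= n.+3)%N -> `|f i| <= C) ->
    `|\sum_(i < n.+2) t i * f i.+2| <= n.+2%:R * (T * C).
  move=> fC; apply: (le_trans (ler_norm_sum _ _ _)).
  rewrite -[X in X%:R * _](card_ord n.+2) mulr_natl -sumr_const.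
  apply: ler_sum => i _; rewrite normrM ler_pM// fC//; exact: (ltn_ord i).
have S1T : `|S1| <= n.+2%:R * (T * C).
  by apply: (sumT (fun i => (quad_rem d1 d2 i).1)) => i /Cbd[].
have S2T : `|S2| <= n.+2%:R * (T * C).
  by apply: (sumT (fun i => (quad_rem d1 d2 i).2)) => i /Cbd[].
have [b1 [b0 /=]] := lattice_point_near S1 S2 v1 v2 d12.
set a1 : int := 2 * b1; set a0 : int := 4 * b0 + 2.
set l : R := a1%:~R + S1; set m : R := a0%:~R + S2 => -[near1 near2].
pose P := family_poly n K M k a0 a1.
pose G x := \sum_(i < n.+2) t i * quad_quo d1 d2 i.+2 x.
have PE x : (map_poly (intr : int -> R) P).[x] =
    (x - d1) * (x - d2) * G x + (l * x + m).
  rewrite (@horner_quad_div _ d1 d2 x _ n.+2); last first.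
    by rewrite (leq_trans (size_poly _ _))// size_family_poly.
  rewrite !coef_map coef0_family_poly coef1_family_poly /l /m /G /S1 /S2.
  have tE (f : nat -> R) : \sum_(i < n.+2) (map_poly intr P)`_i.+2 * f i =
      \sum_(i < n.+2) t i * f i.
    by apply: eq_bigr => i _; rewrite coef_map coef_family_poly.
  by rewrite (tE (fun i => quad_quo d1 d2 i.+2 x)) (tE (fun i => (quad_rem d1 d2 i.+2).1))
    (tE (fun i => (quad_rem d1 d2 i.+2).2)).
have GK x : `|x| <= `|d1| + `|d2| + 1 -> K%:R * M%:R <= G x.
  move=> xr.
  apply: (@quotient_lower_bound _ _ _ _ C t (fun i => quad_quo d1 d2 i.+2 x)) => //.
  - by rewrite /=; ring.
  - move=> i /andP[_ i1]; have /Cbd[_ _] : (i.+2 <= n.+3)%N by [].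
    exact.
  - have -> : t 0 = (2 * (K * M + k 0))%:R by rewrite /t /tail_coef mul1n.
    by rewrite ler_nat -mulnA leq_mul2l leq_addr orbT.
  - by move=> i /andP[i0 _]; rewrite -natr_absz_norm ler_nat tail_coef_small.
have bound1 : `|l * d1 + m| <= h1 * M%:R.
  rewrite -[l * _ + m](subrK v1) (le_trans (ler_normD _ _))//.
  by apply: le_trans v1M; rewrite addrC lerD2l; exact: near1.
have bound2 : `|l * d2 + m| <= h2 * M%:R.
  rewrite -[l * _ + m](subrK v2) (le_trans (ler_normD _ _))//.
  by apply: le_trans v2M; rewrite addrC lerD2l; exact: near2.
have hM (h : R) : h <= 1 -> h * M%:R <= M%:R.
  by move=> h_1; rewrite ler_piMl// ltW.
(* [l] is the slope between the small values at [d1] and [d2]. *)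
have lM : `|l| <= 2 / D * M%:R.
  rewrite mulrAC ler_pdivlMr// /D -normrM.
  rewrite (_ : l * (d1 - d2) = (l * d1 + m) - (l * d2 + m)); last by ring.
  apply: (le_trans (ler_normB _ _)).
  by have := hM _ h1_1; have := hM _ h2_1; lra.
have small (h e : R) : 0 < h -> `|e| <= h * M%:R ->
    `|e| + `|l| * h < h * (D / 2) * (K%:R * M%:R).
  move=> h_0 eh.
  have : `|l| * h <= 2 / D * M%:R * h by rewrite ler_wpM2r// ltW.
  have : (h * M%:R) * (1 + 2 / D) < (h * M%:R) * (D / 2 * K%:R).
    rewrite ltr_pM2l ?mulr_gt0//; move: K2; rewrite ltr_pdivrMr//; lra.
  by lra.
exists P => /=; split.
  split; [exact: monic_family_poly| |exact: size_family_poly|].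
    exact: irreducible_family_poly.
  apply/bigmax_leqP => -[j jP] _ /=; rewrite -(ler_nat R) natr_absz_norm natrM.
  have T0 : 0 <= n.+2%:R * (T * C).
    by rewrite !mulr_ge0// ltW.
  have e1 : 0 <= 2 / D * M%:R by rewrite !mulr_ge0 ?invr_ge0// ltW.
  have e2 : 0 <= 2 / D * `|d1| * M%:R by rewrite !mulr_ge0 ?invr_ge0// ltW.
  apply: (@le_trans _ _ (B0 * M%:R)); last by rewrite ler_wpM2r// ltW.
  have -> : B0 * M%:R = T + n.+2%:R * (T * C) +
      (M%:R + 2 / D * M%:R + 2 / D * `|d1| * M%:R) by rewrite /B0 /T; ring.
  case: j jP => [|[|j]]; rewrite size_family_poly.
  - move=> _; rewrite coef0_family_poly.
    rewrite (_ : a0%:~R = (l * d1 + m) - l * d1 - S2); last by rewrite /m; ring.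
    apply: (le_trans (ler_normB _ _)).
    have := ler_normB (l * d1 + m) (l * d1); rewrite (normrM l d1).
    have : `|l| * `|d1| <= 2 / D * M%:R * `|d1| by rewrite ler_wpM2r.
    have := hM _ h1_1; have := le_trans (normr_ge0 _) (tT 0); lra.
  - move=> _; rewrite coef1_family_poly (_ : a1%:~R = l - S1); last by rewrite /l; ring.
    have := le_trans (normr_ge0 _) (tT 0).
    by have := ler_normB l S1; lra.
  - rewrite !ltnS => j1; rewrite coef_family_poly//.
    by have := tT j; rewrite /t; lra.
have bigx (d h x : R) : `|d| <= `|d1| + `|d2| -> h <= 1 -> `|x - d| <= h ->
    `|x| <= `|d1| + `|d2| + 1.
  by move=> dd h_1 xd; have := ler_normD (x - d) d; rewrite subrK; lra.
split.
- move=> i i1; rewrite coef_family_poly; last exact: ltnW.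
  by rewrite /tail_coef ltn_eqF.
- by rewrite PE subrr !mul0r add0r.
- by rewrite PE subrr mulr0 mul0r add0r.
- apply: (crossing_root (d' := d2) (l := l) (m := m) (g := K%:R * M%:R) (G := G)) => //.
    by move=> x xh; apply/GK/(bigx d1 h1); rewrite ?lerDl.
  exact: small.
- have nD : `|d2 - d1| = D by rewrite distrC.
  apply: (crossing_root (d' := d1) (l := l) (m := m) (g := K%:R * M%:R) (G := G)) => //.
  + by rewrite nD.
  + by move=> x; rewrite PE [(x - d1) * _]mulrC.
  + by move=> x xh; apply/GK/(bigx d2 h2); rewrite ?lerDr.
  + by rewrite nD; exact: small.
Qed.

(** * Counting the points *)

(** The points are indexed by the values [k] of the higher coefficients and by
the indices of the target [(i L, j L)]. *)
Lemma exists_many_points (R : realType) (n : nat) (d1 d2 : R) : d1 != d2 ->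
  exists (B : nat) (L h0 : R), [/\ (0 < B)%N, 0 < L, 0 < h0 &
    forall (M N1 N2 : nat) (h1 h2 : R), (0 < M)%N ->
    0 < h1 <= h0 -> 0 < h2 <= h0 ->
    N1%:R * L <= h1 * M%:R -> N2%:R * L <= h2 * M%:R ->
    exists S : {fset (R * R)},
      (forall p, p \in S -> [/\ `|p.1 - d1| <= h1, `|p.2 - d2| <= h2 &
                               alg_int_points n.+3 (B * M) p]) /\
      #|` S| = (M ^ n.+1 * N1 * N2)%N].
Proof.
move=> d12; have [K [B [h0 [B0 h0_0 exP]]]] := exists_eisenstein_poly n d12.
(* More than twice either rounding error: distinct grid points have disjoint
   neighbourhoods, and the grid stays away from the boundary of the region. *)
pose L : R := 4 * (`|d1| + `|d2| + 2).
have L1 : 2 * (2 * (`|d1| + 1)) < L by rewrite /L; have := normr_ge0 d2; lra.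
have L2 : 2 * (2 * (`|d2| + 1)) < L by rewrite /L; have := normr_ge0 d1; lra.
have L0 : 0 < L by rewrite mulr_gt0// ltr_wpDl// addr_ge0.
exists B, L, h0; split => // M N1 N2 h1 h2 M0 h1h h2h N1M N2M.
have grid (d h : R) N (i : 'I_N) : 2 * (2 * (`|d| + 1)) < L ->
    N%:R * L <= h * M%:R -> `|i%:R * L| + 2 * (`|d| + 1) <= h * M%:R.
  move=> Ld NM; apply: le_trans NM; rewrite ger0_norm; last first.
    by rewrite mulr_ge0// ltW.
  have : i.+1%:R * L <= N%:R * L by rewrite ler_pM2r// ler_nat ltn_ord.
  by rewrite -natr1; lra.
have grid_inj (d y : R) N (i j : 'I_N) : 2 * (2 * (`|d| + 1)) < L ->
    `|y - i%:R * L| <= 2 * (`|d| + 1) -> `|y - j%:R * L| <= 2 * (`|d| + 1) ->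
    i = j.
  move=> Ld yi yj; apply/val_inj/eqP; rewrite /= -(eqr_nat R) -subr_eq0.
  have : `|i%:R * L - j%:R * L| < L.
    by have := ler_distD y (i%:R * L) (j%:R * L); rewrite (distrC (i%:R * L) y); lra.
  rewrite -mulrBl normrM [X in _ * X]gtr0_norm// gtr_pMl//.
  rewrite !pmulrn -intrB -intr_norm -[X in _ < X -> _]/(1%:~R) ltr_int intr_eq0.
  by move: (_ - _) => z; clear; lia.
pose W : finType := ({ffun 'I_n.+1 -> 'I_M} * 'I_N1 * 'I_N2)%type.
pose spec (w : W) (u : {poly int} * (R * R)) :=
  [/\ size u.1 = n.+4, (poly_height u.1 <= B * M)%N,
      is_min_poly u.1 u.2.1 & is_min_poly u.1 u.2.2] /\
  [/\ forall i : 'I_n.+1,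
        u.1`_i.+2 = (2 * ((i == 0 :> nat) * (K * M) + w.1.1 i))%N,
      `|(map_poly intr u.1).[d1] - w.1.2%:R * L| <= 2 * (`|d1| + 1),
      `|(map_poly intr u.1).[d2] - w.2%:R * L| <= 2 * (`|d2| + 1),
      `|u.2.1 - d1| <= h1 & `|u.2.2 - d2| <= h2].
have [f fP] : {f & forall w, spec w (f w)}.
  apply: choice => -[[k i] j].
  have [|||P /= [[mP iP sP hP] [kP v1P v2P [x xd rx] [y yd ry]]]] :=
    exP M h1 h2 (i%:R * L) (j%:R * L) (fun l => k (inord l)) M0 h1h h2h.
  - by move=> l; exact: ltn_ord.
  - exact: grid.
  - exact: grid.
  exists (P, (x, y)); split; split => //= l.
  by rewrite kP// inord_val.
have f_inj : injective (fun w => (f w).2).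
  move=> w w' ff; have [[_ _ m1 _] [kw vw1 vw2 _ _]] := fP w.
  have [[_ _ m1' _] [kw' vw1' vw2' _ _]] := fP w'.
  have PP : (f w).1 = (f w').1 by apply: min_poly_unique m1 _; rewrite ff.
  rewrite -PP in kw' vw1' vw2'.
  move: w w' kw vw1 vw2 kw' vw1' vw2' {ff m1 m1' PP} => [[k i] j] [[k' i'] j'] /=.
  move=> kw vw1 vw2 kw' vw1' vw2'.
  congr (_, _, _); [|exact: grid_inj vw1 vw1'|exact: grid_inj vw2 vw2'].
  apply/ffunP => l; apply: val_inj => /=.
  by move/eqP: (kw l); rewrite kw' eqz_nat eqn_mul2l eqn_add2l => /eqP.
exists [fset p in [seq (f w).2 | w <- enum W]]%fset; split.
  move=> p; rewrite inE/= => /mapP[w _ ->].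
  have [[sw hw m1 m2] [_ _ _ r1 r2]] := fP w.
  by split => //; exists (f w).1.
rewrite card_fseq undup_id; last by rewrite map_inj_uniq ?enum_uniq.
rewrite size_map -cardE.
by rewrite !card_prod card_ffun !card_ord.
Qed.

(** * The rectangle *)

Lemma interval_mid_len_mem (R : realType) (d l : R) (I : set R) (x : R) :
  interval_mid_len d l I -> `|x - d| < l / 2 -> I x.
Proof.
move=> [a [b [ca [cb [-> <- <-]]]]]; rewrite ltr_norml => /andP[xa xb] /=.
rewrite in_itv/=; apply/andP; split; [case: (ca)|case: (cb)] => /=; lra.
Qed.

Lemma measurable_interval_mid_len (R : realType) (d l : R) (I : set R) :
  interval_mid_len d l I -> measurable I.
Proof. by move=> [a [b [ca [cb [-> _ _]]]]]; exact: measurable_itv. Qed.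

Lemma lebesgue_measure_interval_mid_len (R : realType) (d l : R) (I : set R) :
  interval_mid_len d l I -> 0 < l -> lebesgue_measure I = l%:E.
Proof.
move=> [a [b [ca [cb [-> _ <-]]]]]; rewrite subr_gt0 => ab.
by rewrite lebesgue_measure_itv/= lte_fin ab.
Qed.

Lemma mu2_rectangle (R : realType) (d1 d2 l1 l2 : R) (I1 I2 : set R) :
  0 < l1 -> 0 < l2 -> interval_mid_len d1 l1 I1 -> interval_mid_len d2 l2 I2 ->
  mu2 (I1 `*` I2) = (l1 * l2)%:E.
Proof.
move=> l1_0 l2_0 J1 J2; rewrite /mu2 product_measure1E.
- rewrite EFinM; congr (_ * _)%E.
    exact: lebesgue_measure_interval_mid_len J1 l1_0.
  exact: lebesgue_measure_interval_mid_len J2 l2_0.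
- exact: measurable_interval_mid_len J1.
- exact: measurable_interval_mid_len J2.
Qed.

Lemma alg_int_points_le (R : realType) (n H Q : nat) (p : R * R) :
  (H <= Q)%N -> alg_int_points n H p -> alg_int_points n Q p.
Proof.
by move=> HQ [P [m1 m2 sP hP]]; exists P; split => //; exact: leq_trans HQ.
Qed.

Lemma powR_large (R : realType) (c s : R) : 0 < s -> 0 < c ->
  exists2 Q0 : R, 0 < Q0 & forall x : R, Q0 <= x -> c <= x `^ s.
Proof.
move=> s0 c0; exists (c `^ s^-1); first exact: powR_gt0.
move=> x cx; rewrite -[c](powRr1 (ltW c0)) -(mulVf (lt0r_neq0 s0)) powRrM.
have c1 : 0 <= c `^ s^-1 by exact: powR_ge0.
by apply: ge0_ler_powR; rewrite ?nnegrE//; [exact: ltW|exact: le_trans cx].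
Qed.

Lemma half_le_truncn (R : realType) (y : R) : 1 <= y -> y / 2 <= (Num.truncn y)%:R.
Proof.
move=> y1; have y0 : 0 <= y by lra.
have /andP[_] := truncn_itv y0; rewrite -natr1 => yN.
have : (1 : R) <= (Num.truncn y)%:R by rewrite ler1n truncn_ge_nat.
by lra.
Qed.

Lemma count_points_in_rectangle (R : realType) (n : nat) (s1 s2 d1 d2 : R) :
  0 <= s1 < 1 -> 0 <= s2 < 1 -> d1 != d2 ->
  exists c Q0 : R, [/\ 0 < c, 0 < Q0 & forall Q : nat, Q0 < Q%:R ->
    forall I1 I2 : set R,
    interval_mid_len d1 (Q%:R `^ (- s1)) I1 ->
    interval_mid_len d2 (Q%:R `^ (- s2)) I2 ->
    exists S : {fset (R * R)},
      [set` S] `<=` (I1 `*` I2) `&` alg_int_points n.+3 Q /\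
      ((c * Q%:R ^+ n.+3)%:E * mu2 (I1 `*` I2) <= (#|` S|%:R : R)%:E)%E].
Proof.
move=> /andP[s1_0 s1_1] /andP[s2_0 s2_1] d12.
have [B [L [h0 [B0 L0 h0_0 HS]]]] := exists_many_points n d12.
(* Less than 1/2, so that the roots found fall in the interior of the sides. *)
pose h : R := Num.min h0 3^-1.
have h_0 : 0 < h by rewrite lt_min h0_0 invr_gt0 ltr0n.
have [h_h0 h_3] : h <= h0 /\ h <= 3^-1 by split; rewrite ge_min lexx ?orbT.
have BR0 : 0 < B%:R :> R by rewrite ltr0n.
pose e : R := h / (2 * B%:R * L).
have e0 : 0 < e by rewrite divr_gt0// !mulr_gt0.
have [||Q1 Q1_0 Q1P] := @powR_large R e^-1 (1 - s1); rewrite ?subr_gt0 ?invr_gt0//.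
have [||Q2 Q2_0 Q2P] := @powR_large R e^-1 (1 - s2); rewrite ?subr_gt0 ?invr_gt0//.
exists ((2 * B%:R)^-1 ^+ n.+1 * (e / 2) ^+ 2), (B%:R + Q1 + Q2); split.
- by apply: mulr_gt0; apply: exprn_gt0; rewrite ?invr_gt0 ?divr_gt0 ?mulr_gt0 ?ltr0n.
- by rewrite !addr_gt0.
move=> Q Q0Q I1 I2 J1 J2.
have BQ : (B <= Q)%N by rewrite -(ler_nat R); lra.
have Q0 : 0 < Q%:R :> R by lra.
have Qge1 : 1 <= Q%:R :> R by rewrite ler1n (leq_trans B0 BQ).
pose M := (Q %/ B)%N.
have M0 : (0 < M)%N by rewrite divn_gt0.
have M0R : 0 < M%:R :> R by rewrite ltr0n.
have BMQ : (B * M <= Q)%N by rewrite mulnC leq_divM.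
have MQ : (2 * B%:R)^-1 * Q%:R <= M%:R :> R.
  rewrite mulrC ler_pdivrMr ?mulr_gt0// -!natrM ler_nat.
  have := ltn_ceil Q B0; rewrite -/M => QM.
  (* [M >= 1], so rounding [Q / B] down at most halves it *)
  rewrite mulnCA mulnA; apply: leq_trans (ltnW QM) _.
  by rewrite leq_mul2r mul2n -addnn -addn1 leq_add2l M0 orbT.
(* On each side the number of grid steps is at least half of
   [h Q^(-s) M / L >= e Q^(1-s)], a quantity that is at least 1. *)
have side (s : R) : 0 <= s -> e^-1 <= Q%:R `^ (1 - s) ->
    exists2 N : nat, N%:R * L <= h * Q%:R `^ (- s) * M%:R &
      e / 2 * (Q%:R * Q%:R `^ (- s)) <= N%:R.
  move=> s0 eQ; set q := Q%:R `^ (- s).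
  have q0 : 0 < q by exact: powR_gt0.
  have QE : Q%:R `^ (1 - s) = Q%:R * q.
    by rewrite powRD ?lt0r_neq0 ?implybT// powRr1 ?ltW.
  pose y : R := h * q * M%:R / L.
  have y_ge : e * (Q%:R * q) <= y.
    rewrite (_ : e * _ = h * q * ((2 * B%:R)^-1 * Q%:R) / L); last first.
      by rewrite /e; field; rewrite !lt0r_neq0.
    by rewrite ler_pM2r ?invr_gt0// ler_pM2l// mulr_gt0.
  have y1 : 1 <= y.
    by apply: le_trans y_ge; rewrite -QE mulrC -ler_pdivrMr// div1r.
  exists (Num.truncn y).
    by rewrite -ler_pdivlMr// truncn_le (le_trans ler01 y1).
  by apply: le_trans (half_le_truncn y1); rewrite mulrAC ler_pM2r ?invr_gt0.
have [||N1 N1M N1Q] := side s1 => //; first by apply: Q1P; lra.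
have [||N2 N2M N2Q] := side s2 => //; first by apply: Q2P; lra.
have h_le (s : R) : 0 <= s -> 0 < h * Q%:R `^ (- s) <= h0.
  move=> s0; rewrite mulr_gt0 ?powR_gt0//=; apply: le_trans h_h0.
  rewrite ler_piMr//; first exact: ltW.
  by rewrite powRN invf_le1 ?powR_gt0// -[leLHS](powRr0 (Q%:R : R)) ler_powR.
have [S [SP cardS]] := HS M N1 N2 _ _ M0 (h_le s1 s1_0) (h_le s2 s2_0) N1M N2M.
have l1_0 : 0 < Q%:R `^ (- s1) by exact: powR_gt0.
have l2_0 : 0 < Q%:R `^ (- s2) by exact: powR_gt0.
exists S; split.
  move=> p /= /SP[p1 p2 pA]; split; last exact: alg_int_points_le pA.
  have h2 (q : R) : 0 < q -> h * q < q / 2.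
    by move=> q0; rewrite mulrC ltr_pM2l//; lra.
  split.
    by apply: (interval_mid_len_mem J1); rewrite (le_lt_trans p1)// h2.
  by apply: (interval_mid_len_mem J2); rewrite (le_lt_trans p2)// h2.
rewrite (mu2_rectangle l1_0 l2_0 J1 J2) -EFinM lee_fin cardS !natrM natrX.
set q1 := _ `^ (- s1) in l1_0 N1Q *; set q2 := _ `^ (- s2) in l2_0 N2Q *.
rewrite [leLHS](_ : _ = ((2 * B%:R)^-1 * Q%:R) ^+ n.+1 * (e / 2 * (Q%:R * q1))
    * (e / 2 * (Q%:R * q2))); last first.
  move: (2 * B%:R)^-1 (Q%:R : R) (e / 2) => A x y.
  by rewrite exprMn -(addn2 n.+1) exprD; move: (A ^+ _) (x ^+ n.+1) => b c; ring.
have r0 : 0 <= (2 * B%:R)^-1 * Q%:R :> R.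
  by rewrite mulr_ge0 ?ltW// invr_gt0 mulr_gt0.
have t0 (q : R) : 0 < q -> 0 <= e / 2 * (Q%:R * q).
  by move=> q0; rewrite ltW// mulr_gt0 ?divr_gt0 ?mulr_gt0.
rewrite ler_pM ?t0//; first by rewrite mulr_ge0 ?exprn_ge0 ?t0.
by rewrite ler_pM ?exprn_ge0 ?t0// lerXn2r// nnegrE ?ler0n.
Qed.

(** The side of length [Q^(-s)] grows without bound, so it ends up containing the
midpoint [d'] of the other side. *)
Lemma wide_interval_contains (R : realType) (s d d' : R) : s < 0 ->
  exists2 Q0 : R, 0 < Q0 & forall Q : nat, Q0 < Q%:R ->
    forall I, interval_mid_len d (Q%:R `^ (- s)) I -> I d'.
Proof.
move=> s0; pose c : R := 2 * `|d' - d| + 1.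
have c0 : 0 < c by rewrite ltr_wpDl// mulr_ge0.
have [|Q0 Q0_0 Q0P] := @powR_large R c (- s) _ c0; first by rewrite oppr_gt0.
exists Q0 => // Q Q0Q I J; apply: (interval_mid_len_mem J).
by have := Q0P _ (ltW Q0Q); rewrite /c; lra.
Qed.

Theorem theorem1p3 (R : realType) (n : nat) (hn : (4 <= n)%N) :
  exists2 eps0 : R, 0 < eps0 &
  forall eps : R, 0 < eps -> eps < eps0 ->
  forall s1 s2 : R, 0 < s1 + s2 -> s1 + s2 < 1 ->
  forall d1 d2 : R,
  exists c7 Q0 : R, [/\ 0 < c7, 0 < Q0 &
    forall Q : nat, Q0 < Q%:R ->
    forall I1 I2 : set R,
      interval_mid_len d1 (Q%:R `^ (- s1)) I1 ->
      interval_mid_len d2 (Q%:R `^ (- s2)) I2 ->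
      (I1 `*` I2) `&` [set p : R * R | `|p.1 - p.2| <= eps] = set0 ->
      exists S : {fset (R * R)},
        [set` S] `<=` (I1 `*` I2) `&` alg_int_points n Q /\
        ((c7 * Q%:R ^+ n)%:E * mu2 (I1 `*` I2) <= (#|` S|%:R : R)%:E)%E].
Proof.
exists 1 => // eps eps0 _ s1 s2 s_0 s_1 d1 d2.
have diag (I1 I2 : set R) x : I1 x -> I2 x ->
    (I1 `*` I2) `&` [set p : R * R | `|p.1 - p.2| <= eps] = set0 -> False.
  move=> I1x I2x E0; suff : set0 (x, x) by [].
  by rewrite -E0; split => //=; rewrite subrr normr0 ltW.
have mid (d s : R) (Q : nat) I : 0 < Q%:R :> R ->
    interval_mid_len d (Q%:R `^ (- s)) I -> I d.
  move=> Q0 J; apply: (interval_mid_len_mem J).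
  by rewrite subrr normr0 divr_gt0// powR_gt0.
have [d12|d12] := eqVneq d1 d2.
  exists 1, 1; split => // Q Q1 I1 I2 J1 J2 E0; exfalso.
  have Q0 := lt_trans ltr01 Q1.
  by apply: (diag I1 I2 d1) E0; [exact: mid J1|rewrite d12; exact: mid J2].
have [s1_0|s1_0] := ltP s1 0.
  have [Q0 Q0_0 wide] := wide_interval_contains d1 d2 s1_0.
  exists 1, Q0; split => // Q Q0Q I1 I2 J1 J2 E0; exfalso.
  by apply: (diag I1 I2 d2) E0; [exact: wide J1|apply: mid J2; exact: lt_trans Q0Q].
have [s2_0|s2_0] := ltP s2 0.
  have [Q0 Q0_0 wide] := wide_interval_contains d2 d1 s2_0.
  exists 1, Q0; split => // Q Q0Q I1 I2 J1 J2 E0; exfalso.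
  by apply: (diag I1 I2 d1) E0; [apply: mid J1; exact: lt_trans Q0Q|exact: wide J2].
have -> : n = (n - 3).+3 by rewrite -addn3 subnK// ltnW.
have [||//|c [Q0 [c0 Q0_0 count]]] :=
    @count_points_in_rectangle R (n - 3) s1 s2 d1 d2; [lra|lra|].
by exists c, Q0; split => // Q Q0Q I1 I2 J1 J2 _; exact: count.
Qed.
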